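(* Let $V_R$ be a right quasigroup, let $S\subseteq V$ be a subset, and let $\Gamma:=\Gamma(V_R,S)$ be the Cayley digraph of $V_R$ with connection set $S$. The following are equivalent: (1) $(\Gamma,R)$ is a marked digraph that realizes $V_R$. (2) $R$ is a marking of $\Gamma$. (3) For all $h,v\in V$ and $s\in S$, there exists an element $t\in S$ such that $R_tR_h(v)=R_hR_s(v)$.
   Context: A right quasigroup $V_R$ is a pair $(V,R)$ where $V$ is a set and $R:V\to S_V$, $v\mapsto R_v$, is a function to the group of permutations of $V$. Juxtaposition of maps is composition. A digraph is a pair $(V,E)$ with $E\subseteq V\times V$ (loops allowed, no finiteness assumed). An automorphism of a digraph $(V,E)$ is a permutation $\varphi$ of $V$ such that $(\varphi(v),\varphi(w))\in E$ for all $(v,w)\in E$; $\operatorname{Aut}\Gamma$ is the set of automorphisms of $\Gamma$. A marking of a digraph $\Gamma$ with vertex set $V$ is a function $R:V\to\operatorname{Aut}\Gamma$; then $(\Gamma,R)$ is called a marked digraph and it realizes the right quasigroup $(V,R)$. The Cayley digraph $\Gamma(V_R,S)$ is the digraph with vertex set $V$ and edge set $\{(v,R_s(v))\mid v\in V,\ s\in S\}$. *)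

(* Defs.v *)
From mathcomp Require Import all_boot.
From mathcomp Require Import classical_sets.

Set Implicit Arguments.
Unset Strict Implicit.
Unset Printing Implicit Defensive.

Local Open Scope classical_set_scope.

(* MathComp's {perm T} requires T finite; here V is an arbitrary type. *)
Record permutation (V : Type) : Type := Permutation {
  perm_fun :> V -> V;
  perm_bij : bijective perm_fun }.

Record right_quasigroup : Type := RightQuasigroup {
  rq_carrier :> Type;
  rq_perm : rq_carrier -> permutation rq_carrier }.

Record digraph : Type := Digraph {
  vertex : Type;
  edges : set (vertex * vertex) }.

(* The vertex set may be infinite, so edge preservation does not imply edge
   reflection; an automorphism is only required to preserve edges. *)
Definition Aut (G : digraph) : set (permutation (vertex G)) :=
  [set phi | forall v w, edges (v, w) -> edges (phi v, phi w)].

Definition is_marking (G : digraph)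
    (R : vertex G -> permutation (vertex G)) : Prop :=
  forall v, Aut (R v).

Record marked_digraph : Type := MarkedDigraph {
  md_graph : digraph;
  md_marking : vertex md_graph -> permutation (vertex md_graph);
  md_markingP : is_marking md_marking }.

Definition realized (M : marked_digraph) : right_quasigroup :=
  RightQuasigroup (@md_marking M).

Definition realizes (M : marked_digraph) (Q : right_quasigroup) : Prop :=
  realized M = Q.

Definition cayley_digraph (Q : right_quasigroup) (S : set Q) : digraph :=
  Digraph [set (v, rq_perm s v) | v in [set: Q] & s in S].

(* Main.v *)
Require Import Defs.
From mathcomp Require Import all_boot.
From mathcomp Require Import classical_sets.

(** The edges out of [R h v] are the pairs [(R h v, R t (R h v))] with [t] in [S], so the last
    condition says exactly that each [R h] maps edges to edges. Realizing [Q] then only says that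
    the marking is the map [R] of [Q]. *)

Theorem theorem6p1 (Q : right_quasigroup) (S : set Q) :
  let G := cayley_digraph S in
  let R : vertex G -> permutation (vertex G) := @rq_perm Q in
  [<-> exists markR : is_marking R, realizes (MarkedDigraph markR) Q;
       is_marking R;
       forall (h v s : Q), S s ->
         exists2 t : Q, S t & (R t \o R h) v = (R h \o R s) v].
Proof.
move=> G R; tfae.
- by case.
- move=> markR h v s Ss.
  have [|_ _ [t St [-> tE]]] := markR h v (R s v).
    by exists v => //; exists s.
  by exists t.
- move=> closedS.
  have markR : is_marking R.
    move=> h _ _ [v _ [s Ss [<- <-]]].
    have [t St tE] := closedS h v s Ss.
    by exists (R h v) => //; exists t => //; congr pair.
  (* Once [Q] is a constructor applied to its fields, [realizes] holds by reflexivity. *)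
  by exists markR; case: Q S @G @R closedS markR.
Qed.
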